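(* Let $D_n$ and $\varphi$ be as described in the context. If a function $f: D_n \to \mathbb{R}^n$ satisfies the inequality $$\bigl|\,|\langle f(x), f(y)\rangle| - |\langle x, y\rangle|\,\bigr| \le \varphi(x,y)$$ for all $x,y \in D_n$, then $f$ satisfies the generalized orthogonality equation $$|\langle f(x), f(y)\rangle| = |\langle x, y\rangle|$$ for all $x,y\in D_n$.
   Context: Let $n\ge 2$ be a fixed natural number, and let $c>0$ with $c\neq 1$ and $d>0$ be real constants. $\langle\cdot,\cdot\rangle$ is the usual inner product on $\mathbb{R}^n$ and $\|x\|=\sqrt{\langle x,x\rangle}$. Define $D_n=\{x\in\mathbb{R}^n:\|x\|\ge d\}$ if $0<c<1$, and $D_n=\{x\in\mathbb{R}^n:\|x\|<d\}$ if $c>1$. $\varphi:\mathbb{R}^n\times\mathbb{R}^n\to[0,\infty)$ is a symmetric function satisfying (with $\lambda,\mu$ real variables): (i) there is a function $\phi:[0,\infty)\times[0,\infty)\to[0,\infty)$ with $\varphi(x,y)=\phi(\|x\|,\|y\|)$ for all $x,y\in\mathbb{R}^n$; (ii) for all $x,y\in\mathbb{R}^n$, $\frac{1}{|\lambda|}\varphi(\lambda x,y)=O\left(-\frac{\ln c}{\ln|\lambda|}\right)$ as $|\lambda|\to\infty$ (if $0<c<1$), or as $|\lambda|\to0$ (if $c>1$); (iii) for $|\lambda|$ and $|\mu|$ both different from $1$ and for all $x,y\in\mathbb{R}^n$, $\frac{1}{|\lambda\mu|}\varphi(\lambda x,\mu y)=O\left(\left|\frac{\ln c}{\ln|\lambda|}\,\frac{\ln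 c}{\ln|\mu|}\right|\right)$ as $|\lambda\mu|\to\infty$ (if $0<c<1$), or as $|\lambda\mu|\to0$ (if $c>1$). *)

(* Defs.v *)
From HB Require Import structures.
From mathcomp Require Export all_boot all_order all_algebra.
From mathcomp Require Export all_classical all_reals all_analysis.

Set Implicit Arguments.
Unset Strict Implicit.
Unset Printing Implicit Defensive.

Import Order.TTheory GRing.Theory Num.Theory.
Import numFieldNormedType.Exports.

Local Open Scope classical_set_scope.
Local Open Scope ring_scope.

Definition inner (R : realType) (n : nat) (x y : 'rV[R]_n) : R :=
  \sum_(i < n) x 0 i * y 0 i.

(* The library norm on 'rV[R]_n is the sup norm, hence a separate definition. *)
Definition enorm (R : realType) (n : nat) (x : 'rV[R]_n) : R :=
  Num.sqrt (inner x x).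

Definition Dom (R : realType) (n : nat) (c d : R) : set 'rV[R]_n :=
  if c < 1 then [set x | d <= enorm x] else [set x | enorm x < d].

(* Limit taken by a modulus |l|: |l| --> +oo if c < 1, and |l| --> 0 with
   |l| > 0 otherwise (the quotients by |l| only make sense for l != 0). *)
Definition modulus_lim (R : realType) (c : R) : set_system R :=
  if c < 1 then pinfty_nbhs R else 0^'+.

Definition preimage_filter (T U : Type) (g : T -> U) (F : set_system U) :
    set_system T :=
  filter_from F (fun A => g @^-1` A).

(* l : R such that |l| --> +oo (if c < 1) or |l| --> 0 (if c > 1). *)
Definition scalar_lim (R : realType) (c : R) : set_system R :=
  preimage_filter (fun l : R => `|l|) (modulus_lim c).

(* Pairs (l, m) with |l|, |m| != 1 and |l m| --> +oo (if c < 1) or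
   |l m| --> 0 (if c > 1); l and m may vary independently. *)
Definition scalar_pair_lim (R : realType) (c : R) : set_system (R * R) :=
  within [set p : R * R | `|p.1| != 1 /\ `|p.2| != 1]
    (preimage_filter (fun p : R * R => `|p.1 * p.2|) (modulus_lim c)).

#[global] Instance modulus_lim_filter (R : realType) (c : R) :
  Filter (modulus_lim c).
Proof. by rewrite /modulus_lim; case: ifP => _; exact: filter_filter. Qed.

#[global] Instance preimage_filter_filter (T U : Type) (g : T -> U)
  (F : set_system U) : Filter F -> Filter (preimage_filter g F).
Proof.
move=> FF; apply: filter_from_filter; first by exists setT; exact: filterT.
by move=> A B FA FB; exists (A `&` B); first exact: filterI.
Qed.

#[global] Instance scalar_lim_filter (R : realType) (c : R) :
  Filter (scalar_lim c).
Proof. exact: preimage_filter_filter. Qed.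

#[global] Instance scalar_pair_lim_filter (R : realType) (c : R) :
  Filter (scalar_pair_lim c).
Proof. exact: within_filter. Qed.

(* The notation =O_F finds the filter structure of F by canonical projection. *)
Canonical scalar_lim_filter_on (R : realType) (c : R) : filter_on R :=
  FilterType (scalar_lim c) (scalar_lim_filter c).

Canonical scalar_pair_lim_filter_on (R : realType) (c : R) :
  filter_on (R * R) :=
  FilterType (scalar_pair_lim c) (scalar_pair_lim_filter c).

(* Main.v *)
(* Rescaling, [G l x = f (l x) / l] satisfies, in the limit,
   [|<G x, f y>| = |<x, y>|] and [|<G x, G y>| = |<x, y>|].  The vectors [G e_i]
   are thus asymptotically orthonormal; since there are [n] of them, they also
   satisfy Parseval's identity in the limit, which gives [|f x| = |x|].  Then
   equality holds asymptotically in the Cauchy-Schwarz inequality for [G x] and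
   [f x], so [f x] is close to [G x] or [- G x], and [|<f x, f y>|] is the limit
   of [|<G x, f y>|], that is [|<x, y>|]. *)
Require Import Defs.
From mathcomp Require Import all_boot all_order all_algebra.
From mathcomp Require Import all_classical all_reals all_analysis.
From mathcomp Require Import ring.
Import Order.TTheory GRing.Theory Num.Theory.
Import numFieldNormedType.Exports.
Local Open Scope classical_set_scope.
Local Open Scope ring_scope.

(** * The Euclidean inner product *)

Lemma innerE {R : realType} {n : nat} (x y : 'rV[R]_n) :
  inner x y = (x *m y^T) 0 0.
Proof. by rewrite mxE; apply: eq_bigr => i _; rewrite mxE. Qed.

Lemma innerC {R : realType} {n : nat} (x y : 'rV[R]_n) : inner x y = inner y x.
Proof. by apply: eq_bigr => i _; rewrite mulrC. Qed.

Lemma innerZl {R : realType} {n : nat} (a : R) (x y : 'rV[R]_n) :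
  inner (a *: x) y = a * inner x y.
Proof. by rewrite !innerE -scalemxAl mxE. Qed.

Lemma innerZr {R : realType} {n : nat} (a : R) (x y : 'rV[R]_n) :
  inner x (a *: y) = a * inner x y.
Proof. by rewrite innerC innerZl innerC. Qed.

Lemma innerBl {R : realType} {n : nat} (x y z : 'rV[R]_n) :
  inner (x - y) z = inner x z - inner y z.
Proof. by rewrite !innerE mulmxBl !mxE. Qed.

Lemma innerBr {R : realType} {n : nat} (x y z : 'rV[R]_n) :
  inner x (y - z) = inner x y - inner x z.
Proof. by rewrite innerC innerBl !(innerC x). Qed.

Lemma inner_ge0 {R : realType} {n : nat} (x : 'rV[R]_n) : 0 <= inner x x.
Proof. by apply: sumr_ge0 => i _; rewrite -expr2 sqr_ge0. Qed.

Lemma inner_eq0 {R : realType} {n : nat} (x : 'rV[R]_n) :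
  (inner x x == 0) = (x == 0).
Proof.
apply/idP/eqP => [|->]; last by rewrite innerE mul0mx mxE.
rewrite psumr_eq0; last by move=> i _; rewrite -expr2 sqr_ge0.
move=> /allP x0; apply/rowP => i; rewrite mxE; apply/eqP.
by have := x0 i (mem_index_enum _); rewrite /= mulf_eq0 orbb.
Qed.

Lemma enormZ {R : realType} {n : nat} (a : R) (x : 'rV[R]_n) :
  0 <= a -> enorm (a *: x) = a * enorm x.
Proof.
move=> a0; rewrite /enorm innerZl innerZr mulrA -expr2.
by rewrite sqrtrM ?sqr_ge0 // sqrtr_sqr ger0_norm.
Qed.

(** For [y != 0], the squared norm of [inner y y *: x - inner x y *: y] is nonnegative and equals
    [inner y y] times the difference of the two sides. *)
Lemma Cauchy_Schwarz_inner {R : realType} {n : nat} (x y : 'rV[R]_n) :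
  inner x y ^+ 2 <= inner x x * inner y y.
Proof.
have [->|y0] := eqVneq y 0.
  by rewrite !innerE trmx0 !mulmx0 !mxE expr0n mulr0.
have yy : 0 < inner y y by rewrite lt0r inner_eq0 y0 inner_ge0.
have := inner_ge0 (inner y y *: x - inner x y *: y).
rewrite innerBl !innerBr !innerZl !innerZr (innerC y x) => h.
rewrite -(ler_pM2l yy) -subr_ge0.
by apply: le_trans h _; rewrite le_eqVlt; apply/orP; left; apply/eqP; ring.
Qed.

(** * Limits of finite sums and of squares *)

Lemma cvg_sum {R : numFieldType} {T : Type} {F : set_system T} {FF : Filter F}
    {I : finType} (f : I -> T -> R) (l : I -> R) :
  (forall i, f i x @[x --> F] --> l i) ->
  (\sum_i f i x) @[x --> F] --> \sum_i l i.
Proof. by move=> fl; apply: cvg_big => //; exact: add_continuous. Qed.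

Lemma cvg_sum0 {R : numFieldType} {T : Type} {F : set_system T} {FF : Filter F}
    {I : finType} (f : I -> T -> R) :
  (forall i, f i x @[x --> F] --> 0) -> (\sum_i f i x) @[x --> F] --> 0.
Proof.
move=> f0.
rewrite [X in _ --> X](_ : 0 = \sum_(i : I) 0); last by rewrite big1_eq.
exact: cvg_sum.
Qed.

Lemma cvg_sqr {R : numFieldType} {T : Type} {F : set_system T} {FF : Filter F}
  (f : T -> R) (a : R) : f x @[x --> F] --> a -> f x ^+ 2 @[x --> F] --> a ^+ 2.
Proof.
by move=> fa; under eq_cvg do rewrite expr2; rewrite expr2; exact: cvgM.
Qed.

Lemma cvg_sqr0 {R : realFieldType} {T : Type} {F : set_system T} {FF : Filter F}
  (f : T -> R) : f x ^+ 2 @[x --> F] --> 0 -> f x @[x --> F] --> 0.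
Proof.
move=> /cvgrPdist_lt f0; apply/cvgrPdist_lt => e e0.
have /f0 : 0 < e ^+ 2 by rewrite exprn_gt0.
apply: filterS => x; rewrite !sub0r !normrN normrX.
by rewrite ltr_pXn2r // nnegrE ltW.
Qed.

(** * Asymptotically orthonormal frames *)

(* Both sides are traces of squares, and the trace is cyclic. *)
Lemma mxtrace_gram_defect {R : realType} {n : nat} (A : 'M[R]_n) :
  \sum_i \sum_j ((A^T *m A - 1%:M) i j) ^+ 2 =
  \sum_i \sum_j ((A *m A^T - 1%:M) i j) ^+ 2.
Proof.
have sq (B : 'M[R]_n) : B^T = B ->
    \sum_i \sum_j (B i j) ^+ 2 = \tr (B *m B).
  move=> Bs; apply: eq_bigr => i _; rewrite mxE; apply: eq_bigr => j _.
  have -> : B j i = B i j by rewrite -[in LHS]Bs mxE.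
  by rewrite expr2.
rewrite !sq; try by rewrite linearB /= trmx1 trmx_mul trmxK.
rewrite !mulmxBl !mulmxBr !mulmx1 !mul1mx !linearB /=.
by rewrite (mxtrace_mulC A^T A) -(mulmxA A^T) (mxtrace_mulC A^T) !mulmxA.
Qed.

(** Passes from almost orthonormal rows to almost orthonormal columns, without any convergence of
    [A t] itself: each squared entry of one defect is at most the sum of all of them, which is the
    same for the other defect. *)
Lemma cvg_gram_trmx {R : realType} {n : nat} {T : Type} {F : set_system T}
    {FF : Filter F} (A : T -> 'M[R]_n) :
  (forall i j, (A t *m (A t)^T - 1%:M) i j @[t --> F] --> 0) ->
  forall i j, ((A t)^T *m A t - 1%:M) i j @[t --> F] --> 0.
Proof.
move=> A0 i j; apply: cvg_sqr0.
apply: (@squeeze_cvgr _ _ _ _ (fun=> 0) (fun t =>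
  \sum_i \sum_j ((A t *m (A t)^T - 1%:M) i j) ^+ 2)).
- apply: nearW => t /=; rewrite sqr_ge0 /= -mxtrace_gram_defect.
  rewrite (bigD1 i) //= (bigD1 j) //= -addrA lerDl addr_ge0 //.
    by apply: sumr_ge0 => *; exact: sqr_ge0.
  by apply: sumr_ge0 => *; apply: sumr_ge0 => *; exact: sqr_ge0.
- exact: cvg_cst.
- apply: cvg_sum0 => k; apply: cvg_sum0 => l.
  by rewrite -[X in _ --> X](expr0n _ 2); exact: cvg_sqr (A0 k l).
Qed.

(** Parseval in the limit: the sum [S t] of the squared coefficients of [v] tends to [inner x x] by
    the second hypothesis and to [inner v v] by almost orthonormality, and limits are unique. *)
Lemma inner_eq_of_cvg_frame {R : realType} {n : nat} {T : Type}
    {F : set_system T} {FF : ProperFilter F} (g : T -> 'I_n -> 'rV[R]_n)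
    (v x : 'rV[R]_n) :
  (forall i j, `|inner (g t i) (g t j)| @[t --> F] --> ((i == j)%:R : R)) ->
  (forall i, `|inner (g t i) v| @[t --> F] --> `|x 0 i|) ->
  inner v v = inner x x.
Proof.
move=> gg gv; pose A t := \matrix_i g t i.
have AE t i j : (A t *m (A t)^T) i j = inner (g t i) (g t j).
  by rewrite !mxE; apply: eq_bigr => k _; rewrite !mxE.
have A0 i j : (A t *m (A t)^T - 1%:M) i j @[t --> F] --> 0.
  have -> : (fun t => (A t *m (A t)^T - 1%:M) i j) =
      (fun t => inner (g t i) (g t j) - (i == j)%:R).
    by apply/funext => t; rewrite -AE mxE [X in _ + X]mxE [X in _ - X]mxE.
  have := gg i j; case: eqP => [<-|_] gij.
    rewrite -(subrr 1); apply: cvgB; last exact: cvg_cst.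
    by under eq_cvg do rewrite -(ger0_norm (inner_ge0 _)).
  by under eq_cvg do rewrite subr0; apply: norm_cvg0.
have B0 := cvg_gram_trmx A A0.
pose S t := \sum_i inner (g t i) v ^+ 2.
have Sx : S t @[t --> F] --> inner x x.
  apply: cvg_sum => i; rewrite -expr2 -(@real_normK _ (x 0 i)) ?num_real //.
  under eq_cvg do rewrite -real_normK ?num_real //.
  by apply: cvg_sqr; exact: gv.
have Sv : S t @[t --> F] --> inner v v.
  (* [S t] is the quadratic form of [(A t)^T *m A t] at [v]; splitting off the identity matrix
     leaves an error governed by the column defect. *)
  have SE t : S t =
      inner v v + \sum_j (\sum_k v 0 k * ((A t)^T *m A t - 1%:M) k j) * v 0 j.
    have vA i : inner (g t i) v = (v *m (A t)^T) 0 i.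
      by rewrite mxE; apply: eq_bigr => k _; rewrite !mxE mulrC.
    transitivity ((v *m (1%:M + ((A t)^T *m A t - 1%:M)) *m v^T) 0 0).
      rewrite addrC subrK mulmxA -mulmxA -{2}(trmxK (A t)) -trmx_mul mxE.
      by apply: eq_bigr => i _; rewrite vA [X in _ * X]mxE expr2.
    rewrite mulmxDr mulmx1 mulmxDl mxE -innerE; congr (_ + _).
    by rewrite mxE; apply: eq_bigr => j _; rewrite mxE [X in _ * X]mxE.
  rewrite -[X in _ --> X]addr0; under eq_cvg do rewrite SE.
  apply: cvgD; first exact: cvg_cst.
  apply: cvg_sum0 => j; rewrite -[X in _ --> X](mul0r (v 0 j)).
  apply: cvgM; last exact: cvg_cst.
  apply: cvg_sum0 => k; rewrite -[X in _ --> X](mulr0 (v 0 k)).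
  by apply: cvgM; [exact: cvg_cst | exact: B0].
exact: (cvg_unique (@Rhausdorff R) Sv Sx).
Qed.

(* [h t] is up to a vanishing error a signed copy of [v], since equality
   holds asymptotically in the Cauchy-Schwarz inequality. *)
Lemma inner_cvg_of_cvg_abs {R : realType} {n : nat} {T : Type}
    {F : set_system T} {FF : Filter F} (h : T -> 'rV[R]_n) (u v : 'rV[R]_n) :
  inner (h t) (h t) @[t --> F] --> inner v v ->
  `|inner (h t) v| @[t --> F] --> inner v v ->
  `|inner (h t) u| @[t --> F] --> `|inner u v|.
Proof.
move=> hh hv.
(* This is the squared distance from [v] to [s *: h t], for the sign [s] that makes
   [s * inner (h t) v] nonnegative. *)
pose q t := inner v v + inner (h t) (h t) - 2 * `|inner (h t) v|.
have q0 : inner u u * q t @[t --> F] --> 0.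
  have -> : 0 = inner u u * (inner v v + inner v v - 2 * inner v v) by ring.
  apply: cvgM; first exact: cvg_cst.
  apply: cvgB; first by apply: cvgD => //; exact: cvg_cst.
  by apply: cvgM => //; exact: cvg_cst.
rewrite -[X in _ --> X]add0r.
under eq_cvg => t do rewrite -(subrK `|inner u v| `|inner (h t) u|).
apply: cvgD; last exact: cvg_cst.
apply: cvg_sqr0; apply: (@squeeze_cvgr _ _ _ _ (fun=> 0) _ _ _ _ _ q0);
  last exact: cvg_cst.
apply: nearW => t /=; rewrite sqr_ge0 /=.
have [s s1 sE] : exists2 s : R,
    s ^+ 2 = 1 & `|inner (h t) v| = s * inner (h t) v.
  case: (ger0P (inner (h t) v)) => _; first by exists 1; rewrite ?expr1n ?mul1r.
  by exists (-1); rewrite ?sqrrN ?expr1n ?mulN1r.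
have ns : `|s| = 1.
  by apply/eqP; rewrite -sqrp_eq1 // real_normK ?num_real // s1.
have -> : q t = inner (v - s *: h t) (v - s *: h t).
  rewrite /q sE innerBl !innerBr !innerZl !innerZr (innerC v (h t)).
  by rewrite (mulrA s s) -expr2 s1; ring.
(* Cauchy-Schwarz is applied to [u] and [v - s *: h t]; as [s] has modulus 1, the reverse triangle
   inequality then bounds the difference of the absolute values. *)
apply: le_trans (Cauchy_Schwarz_inner _ _).
rewrite innerBr innerZr -[leLHS]real_normK ?num_real //.
rewrite -[leRHS]real_normK ?num_real // ler_pXn2r ?nnegrE //.
apply: le_trans (ler_dist_dist _ _) => //.
by rewrite normrM ns mul1r (innerC u (h t)) distrC.
Qed.

Lemma cvg_of_dist_le {R : realFieldType} {T : Type} {F : set_system T}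
    {FF : Filter F} (a e : T -> R) (b : R) :
  (\forall t \near F, `|a t - b| <= e t) -> e t @[t --> F] --> 0 ->
  a t @[t --> F] --> b.
Proof.
move=> ae /cvgrPdist_lt e0; apply/cvgrPdist_lt => eps eps0.
have := e0 _ eps0; apply: filterS2 ae => t le1.
rewrite sub0r normrN distrC => lt2.
exact: le_lt_trans le1 (le_lt_trans (ler_norm _) lt2).
Qed.

(** * Limits in the modulus of the scalars *)

#[global] Instance modulus_lim_proper {R : realType} {c : R} :
  ProperFilter (modulus_lim c).
Proof. by rewrite /modulus_lim; case: ifP => _; exact: _. Qed.

Section ModulusLim.
Context {R : realType} {c : R}.

Lemma modulus_lim_gt0 : \forall l \near modulus_lim c, 0 < l.
Proof.
rewrite /modulus_lim; case: ifP => _; last exact: nbhs_right_gt.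
by apply: nbhs_pinfty_gt; rewrite num_real.
Qed.

Lemma modulus_lim_neq1 : \forall l \near modulus_lim c, l != 1.
Proof.
rewrite /modulus_lim; case: ifP => _.
  have : \forall l \near +oo, 1 < (l : R).
    by apply: nbhs_pinfty_gt; rewrite num_real.
  by apply: filterS => l /gt_eqF ->.
have : \forall l \near (0 : R)^'+, l < 1 by exact: nbhs_right_lt.
by apply: filterS => l /lt_eqF ->.
Qed.

Lemma modulus_lim_sqr (A : set R) :
  modulus_lim c A -> \forall l \near modulus_lim c, A (l * l).
Proof.
rewrite /modulus_lim; case: ifP => _.
  move=> FA; have := @cvgr_expr2 R _ FA.
  by rewrite /nbhs /=; apply: filterS => l; rewrite /= expr2.
have : \forall l \near (0 : R)^'+, 0 < l * l.
  by apply: filterS (nbhs_right_gt 0) => l l0; exact: mulr_gt0.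
have sqr0 : l * l @[l --> (0 : R)^'+] --> (0 : R).
  rewrite -[X in _ --> X](mulr0 0).
  by apply: cvgM; exact: cvg_at_right_filter (@cvg_id _ _).
by move=> ll0 /sqr0; apply: filterS2 ll0 => l l0; exact.
Qed.

(** The logarithm tends to [+oo] in one regime and to [-oo] in the other. This is what makes both
    decay bounds vanish. *)
Lemma cvg_modulus_lim_ln : (ln l)^-1 @[l --> modulus_lim c] --> 0.
Proof.
rewrite /modulus_lim; case: ifP => _.
  have ln_gt A : \forall l \near +oo, A < ln (l : R).
    have : \forall l \near +oo, expR A < (l : R).
      by apply: nbhs_pinfty_gt; rewrite num_real.
    apply: filterS => l Al.
    by rewrite -(expRK A) ltr_ln // posrE ?expR_gt0 // (lt_trans (expR_gt0 A)).
  by apply/(gtr0_cvgV0 (ln_gt 0)); apply/cvgryPgt.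
apply/ltr0_cvgV0; last exact: lnNy.
exact: (cvgrNy_lt (@lnNy R)).
Qed.

Lemma near_scalar_lim (P : set R) :
  scalar_lim c P -> \forall l \near modulus_lim c, P l.
Proof.
move=> [A FA AP]; apply: filterS2 FA modulus_lim_gt0 => l Al l0.
by apply: AP; rewrite /= gtr0_norm.
Qed.

(** Restriction to the diagonal: squaring preserves both regimes, so the product [l * l] follows the
    same limit, and eventually [l] is positive and differs from 1, as the pair filter requires. *)
Lemma near_scalar_pair_lim (P : set (R * R)) :
  scalar_pair_lim c P -> \forall l \near modulus_lim c, P (l, l).
Proof.
move=> [A /modulus_lim_sqr FA AP]; near=> l.
have l0 : 0 < l by near: l; exact: modulus_lim_gt0.
have l1 : l != 1 by near: l; exact: modulus_lim_neq1.
apply: AP => /=; last by rewrite gtr0_norm.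
by rewrite gtr0_norm ?mulr_gt0 //; near: l.
Unshelve. all: by end_near.
Qed.

(** The threshold is [d / enorm x] in both regimes: [l] grows when the domain is the exterior of the
    ball and shrinks when it is the ball. *)
Lemma near_Dom {n : nat} {d : R} (x : 'rV[R]_n) : 0 < d -> x != 0 ->
  \forall l \near modulus_lim c, Dom c d (l *: x).
Proof.
move=> d0 x0.
have ex : 0 < enorm x by rewrite sqrtr_gt0 lt0r inner_eq0 x0 inner_ge0.
have := modulus_lim_gt0; rewrite /modulus_lim /Dom; case: ifP => _ gt0.
  have : \forall l \near +oo, d / enorm x < (l : R).
    by apply: nbhs_pinfty_gt; rewrite num_real.
  apply: filterS2 gt0 => l l0 dl.
  by rewrite /= enormZ ?ltW // -ltr_pdivrMr.
have : \forall l \near (0 : R)^'+, l < d / enorm x.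
  by apply: nbhs_right_lt; rewrite divr_gt0.
apply: filterS2 gt0 => l l0 dl.
by rewrite /= enormZ ?ltW // -ltr_pdivlMr.
Qed.

End ModulusLim.

(** * From the limit relations to the exact equation *)

Lemma orthogonality_of_asymptotic_extension {R : realType} {n : nat}
    {T : Type} {F : set_system T} {FF : ProperFilter F}
    (D : set 'rV[R]_n) (f : 'rV[R]_n -> 'rV[R]_n)
    (G : T -> 'rV[R]_n -> 'rV[R]_n) :
  (forall x y, x != 0 -> D y ->
    `|inner (G t x) (f y)| @[t --> F] --> `|inner x y|) ->
  (forall x y, x != 0 -> y != 0 ->
    `|inner (G t x) (G t y)| @[t --> F] --> `|inner x y|) ->
  forall x y, D x -> D y -> `|inner (f x) (f y)| = `|inner x y|.
Proof.
move=> Gf GG.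
pose e (i : 'I_n) : 'rV[R]_n := delta_mx 0 i.
have eE i x : inner (e i) x = x 0 i.
  rewrite /inner (bigD1 i) //= big1 ?addr0 => [|j ji].
    by rewrite mxE !eqxx mul1r.
  by rewrite mxE (negbTE ji) andbF mul0r.
have e0 i : e i != 0.
  by rewrite -inner_eq0 eE mxE !eqxx oner_neq0.
have ff x : D x -> inner (f x) (f x) = inner x x.
  move=> Dx.
  apply: (inner_eq_of_cvg_frame (F := F) (fun t i => G t (e i))) => [i j|i].
    have := GG _ _ (e0 i) (e0 j).
    by rewrite eE mxE eqxx /= eq_sym normr_nat.
  by have := Gf _ _ (e0 i) Dx; rewrite eE.
(* The limit relations exclude [x = 0], since scaling cannot move 0 into the domain; here norm
   preservation forces [f x = 0]. *)
move=> x y Dx Dy; have [x0|x0] := eqVneq x 0.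
  have fx0 : f x = 0.
    by apply/eqP; rewrite -inner_eq0 ff // x0 inner_eq0.
  by rewrite fx0 x0 !innerE !mul0mx !mxE.
have hh : inner (G t x) (G t x) @[t --> F] --> inner (f x) (f x).
  have := GG _ _ x0 x0; rewrite ff // (ger0_norm (inner_ge0 x)).
  by under eq_cvg do rewrite (ger0_norm (inner_ge0 _)).
have hv : `|inner (G t x) (f x)| @[t --> F] --> inner (f x) (f x).
  by have := Gf _ _ x0 Dx; rewrite ff // (ger0_norm (inner_ge0 x)).
have h1 : `|inner (G t x) (f y)| @[t --> F] --> `|inner (f x) (f y)|.
  by rewrite (innerC (f x)); exact: inner_cvg_of_cvg_abs hh hv.
exact: (cvg_unique (@Rhausdorff R) h1 (Gf _ _ x0 Dy)).
Qed.

Theorem theorem14 (R : realType) (n : nat) (c d : R)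
  (hn : (2 <= n)%N) (c_gt0 : 0 < c) (c_neq1 : c != 1) (d_gt0 : 0 < d)
  (phi : 'rV[R]_n -> 'rV[R]_n -> R)
  (phi_ge0 : forall x y : 'rV[R]_n, 0 <= phi x y)
  (phi_sym : forall x y : 'rV[R]_n, phi x y = phi y x)
  (phi_radial : exists psi : R -> R -> R,
    (forall s t : R, 0 <= s -> 0 <= t -> 0 <= psi s t) /\
    (forall x y : 'rV[R]_n, phi x y = psi (enorm x) (enorm y)))
  (phi_decay1 : forall x y : 'rV[R]_n,
    (fun l : R => `|l|^-1 * phi (l *: x) y : R^o)
      =O_ (scalar_lim c)
    (fun l : R => - (ln c / ln `|l|) : R^o))
  (phi_decay2 : forall x y : 'rV[R]_n,
    (fun p : R * R => `|p.1 * p.2|^-1 * phi (p.1 *: x) (p.2 *: y) : R^o)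
      =O_ (scalar_pair_lim c)
    (fun p : R * R => `|(ln c / ln `|p.1|) * (ln c / ln `|p.2|)| : R^o))
  (f : 'rV[R]_n -> 'rV[R]_n)
  (hf : forall x y : 'rV[R]_n, Dom c d x -> Dom c d y ->
    `| `|inner (f x) (f y)| - `|inner x y| | <= phi x y) :
  forall x y : 'rV[R]_n, Dom c d x -> Dom c d y ->
    `|inner (f x) (f y)| = `|inner x y|.
Proof.
have r0 : ln c / ln l @[l --> modulus_lim c] --> 0.
  rewrite -[X in _ --> X](mulr0 (ln c)).
  by apply: cvgM; [exact: cvg_cst | exact: cvg_modulus_lim_ln].
apply: (orthogonality_of_asymptotic_extension (F := modulus_lim c) (Dom c d) f
  (fun l x => l^-1 *: f (l *: x))) => x y x0.
- move=> Dy; have /eqO_exP[k k0 /near_scalar_lim dec] := phi_decay1 x y.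
  apply: (@cvg_of_dist_le _ _ _ _ _ (fun l => k * `|ln c / ln l|)).
    apply: filterS3 dec modulus_lim_gt0 (near_Dom x d_gt0 x0) => l dec l0 Dlx.
    rewrite normrN !(gtr0_norm l0) in dec.
    apply: le_trans (le_trans (ler_norm _) dec).
    rewrite innerZl normrM gtr0_norm ?invr_gt0 //.
    (* Homogeneity gives both terms the factor [l^-1], so that [hf] applies at [l *: x] and [y]. *)
    have -> : `|inner x y| = l^-1 * `|inner (l *: x) y|.
      by rewrite innerZl normrM (gtr0_norm l0) mulKf ?gt_eqF.
    rewrite -mulrBr normrM gtr0_norm ?invr_gt0 //.
    by rewrite ler_pM2l ?invr_gt0 //; exact: hf.
  rewrite -[X in _ --> X](mulr0 k); apply: cvgM; first exact: cvg_cst.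
  by apply/norm_cvg0P.
- move=> y0; have /eqO_exP[k k0 /near_scalar_pair_lim dec] := phi_decay2 x y.
  (* Both arguments are rescaled by the same [l], so the error is bounded by a multiple of the
     squared rate. *)
  apply: (@cvg_of_dist_le _ _ _ _ _
    (fun l => k * `|(ln c / ln l) * (ln c / ln l)|)).
    near=> l.
    have l0 : 0 < l by near: l; exact: modulus_lim_gt0.
    have Dx : Dom c d (l *: x) by near: l; exact: near_Dom.
    have Dy : Dom c d (l *: y) by near: l; exact: near_Dom.
    have : `| `|l * l|^-1 * phi (l *: x) (l *: y)| <=
        k * `| `|(ln c / ln `|l|) * (ln c / ln `|l|)| | by near: l; exact: dec.
    rewrite normr_id !(gtr0_norm l0) (gtr0_norm (mulr_gt0 l0 l0)) => le1.
    apply: le_trans (le_trans (ler_norm _) le1).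
    rewrite innerZl innerZr mulrA -invfM.
    have ll : 0 < (l * l)^-1 by rewrite invr_gt0 mulr_gt0.
    rewrite normrM (gtr0_norm ll).
    have -> : `|inner x y| = (l * l)^-1 * `|inner (l *: x) (l *: y)|.
      rewrite innerZl innerZr mulrA normrM (gtr0_norm (mulr_gt0 l0 l0)).
      by rewrite mulKf ?gt_eqF ?mulr_gt0.
    by rewrite -mulrBr normrM (gtr0_norm ll) ler_pM2l //; exact: hf.
  rewrite -[X in _ --> X](mulr0 k); apply: cvgM; first exact: cvg_cst.
  apply/norm_cvg0P; rewrite -[X in _ --> X](mulr0 0); exact: cvgM.
Unshelve. all: by end_near.
Qed.
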